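(* Let $\{\theta_t\}$ be generated by AEGDM in the stochastic setting (defined in the context) with $0\le\mu<1$ and $\eta>0$. Suppose that: 1. (Smoothness) $f$ is $L$-smooth: $f(y)\le f(x)+\nabla f(x)^\top(y-x)+\frac L2\|y-x\|^2$ for all $x,y\in\mathbb{R}^n$. 2. (Independent samples) The random samples $\{\xi_t\}$ are independent. 3. (Unbiasedness) $\mathbb{E}_{\xi_t}[\nabla f(\theta_t;\xi_t)]=\nabla f(\theta_t)$ and $\mathbb{E}_{\xi_t}[f(\theta_t;\xi_t)]=f(\theta_t)$. 4. (Bounded variance) $\mathbb{E}_{\xi_t}[\|\nabla f(\theta_t;\xi_t)-\nabla f(\theta_t)\|^2]\le\sigma_g^2$ and $\mathbb{E}_{\xi_t}[|f(\theta_t;\xi_t)-f(\theta_t)|^2]\le\sigma_f^2$. Assume moreover that $\|\nabla f(\theta_t;\xi_t)\|\le G_\infty$ and $0<a\le f(\theta_t;\xi_t)+c\le B$ for all $t$. Then for all $T\ge1$, $$\frac1T\,\mathbb{E}\left[\min_i r_{T,i}\sum_{t=0}^{T-1}\|\nabla f(\theta_t)\|^2\right]\le\frac{C_1+C_2\,n+C_3\,\sigma_g\sqrt{nT}}{\eta T},$$ where $C_1,C_2,C_3$ are constants depending only on $\mu,\eta,L,G_\infty,a,B,n$ and $f(\theta_0)+c$ (in particular not on $T$).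
   Context: Stochastic setting: $\xi$ is a random variable; for each value of $\xi$, $f(\cdot;\xi):\mathbb{R}^n\to\mathbb{R}$ is differentiable (possibly nonconvex), and $c$ is a constant with $f(\theta;\xi)+c>0$ for all $\theta$ and $\xi$. Put $f(\theta)=\mathbb{E}_\xi[f(\theta;\xi)]$, a differentiable function. Let $\xi_0,\xi_1,\dots$ be random samples, each with the distribution of $\xi$. The initial point $\theta_0\in\mathbb{R}^n$ is deterministic. $\|\cdot\|$ is the Euclidean norm. $\mathbb{E}_{\xi_t}$ denotes expectation over $\xi_t$ with $\theta_t$ held fixed (conditional on the past), and $\mathbb{E}$ denotes expectation over all samples; all random quantities are assumed measurable. AEGDM with step size $\eta$ and momentum parameter $\mu$ is the iteration, for $t\ge0$ and $i\in\{1,\dots,n\}$, $$v_{t,i}=\frac{\partial_i f(\theta_t;\xi_t)}{2\sqrt{f(\theta_t;\xi_t)+c}},\qquad m_{t+1,i}=\mu m_{t,i}+v_{t,i},\quad m_{0,i}=0,$$ $$r_{t+1,i}=\frac{r_{t,i}}{1+2\eta v_{t,i}^2},\quad r_{0,i}=\sqrt{f(\theta_0;\xi_0)+c},\qquad \theta_{t+1,i}=\theta_{t,i}-2\eta\, r_{t+1,i}m_{t+1,i}.$$ *)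

(* Defs.v *)
From HB Require Import structures.
From mathcomp Require Import all_boot all_order all_algebra.
From mathcomp Require Import all_classical all_reals all_analysis.

Set Implicit Arguments.
Unset Strict Implicit.
Unset Printing Implicit Defensive.

Import Order.TTheory GRing.Theory Num.Theory.
Import numFieldNormedType.Exports.

Local Open Scope classical_set_scope.
Local Open Scope ring_scope.

Definition dotv (R : realType) (n : nat) (u v : 'rV[R]_n) : R :=
  \sum_(i < n) u 0 i * v 0 i.

(* The library norm `|u| on 'rV[R]_n is the max norm; this is the Euclidean
   one. *)
Definition norm2 (R : realType) (n : nat) (u : 'rV[R]_n) : R :=
  Num.sqrt (dotv u u).

Definition grad (R : realType) (n : nat) (g : 'rV[R]_n -> R) (x : 'rV[R]_n)
    : 'rV[R]_n :=
  \row_(i < n) 'D_(delta_mx 0 i) g x.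

Definition L_smooth (R : realType) (n : nat) (L : R) (g : 'rV[R]_n -> R) :=
  forall x y : 'rV[R]_n,
    g y <= g x + dotv (grad g x) (y - x) + L / 2 * norm2 (y - x) ^+ 2.

(* The starting value of the fold is itself one of the entries, so this is the
   minimum of the entries of u. *)
Definition min_entry (R : realType) (n : nat) (u : 'rV[R]_n.+1) : R :=
  \big[Num.min/u 0 ord0]_(i < n.+1) u 0 i.

Definition mutually_independent (R : realType) (d d' : measure_display)
    (Omega : measurableType d) (Xi : measurableType d')
    (P : probability Omega R) (X : nat -> {RV P >-> Xi}) :=
  forall (I : seq nat) (A : nat -> set Xi),
    uniq I -> (forall i, measurable (A i)) ->
    P (\bigcap_(i in [set` I]) (X i @^-1` A i)) =
    (\prod_(i <- I) P (X i @^-1` A i))%E.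

Definition same_distribution (R : realType) (d d' : measure_display)
    (Omega : measurableType d) (Xi : measurableType d')
    (P : probability Omega R) (X Y : {RV P >-> Xi}) :=
  forall A : set Xi, measurable A -> distribution P X A = distribution P Y A.

(* The triple (theta_t, m_t, r_t). *)
Record aegdm_state (R : realType) (n : nat) := AegdmState {
  st_theta : 'rV[R]_n;
  st_m : 'rV[R]_n;
  st_r : 'rV[R]_n }.

Section AEGDM.
Context (R : realType) (n : nat) (Xi : Type).
(* F x s is f(x; s), and s t is the realization of the t-th sample. *)
Variables (F : 'rV[R]_n -> Xi -> R) (c eta mu : R).

Definition aegdm_v (x : 'rV[R]_n) (s : Xi) : 'rV[R]_n :=
  \row_(i < n) (grad (F ^~ s) x 0 i / (2 * Num.sqrt (F x s + c))).

Definition aegdm_init (x0 : 'rV[R]_n) (s : Xi) : aegdm_state R n :=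
  AegdmState x0 0 (const_mx (Num.sqrt (F x0 s + c))).

Definition aegdm_step (s : Xi) (z : aegdm_state R n) : aegdm_state R n :=
  let v := aegdm_v (st_theta z) s in
  let m := mu *: st_m z + v in
  let r := \row_(i < n) (st_r z 0 i / (1 + 2 * eta * v 0 i ^+ 2)) in
  let theta := \row_(i < n) (st_theta z 0 i - 2 * eta * r 0 i * m 0 i) in
  AegdmState theta m r.

Fixpoint aegdm (x0 : 'rV[R]_n) (s : nat -> Xi) (t : nat) : aegdm_state R n :=
  if t is t'.+1 then aegdm_step (s t') (aegdm x0 s t')
  else aegdm_init x0 (s 0%N).

Definition aegdm_theta x0 s t := st_theta (aegdm x0 s t).
Definition aegdm_r x0 s t := st_r (aegdm x0 s t).

End AEGDM.

(* Main.v *)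
Require Import Defs.
From HB Require Import structures.
From mathcomp Require Import all_boot all_order all_algebra.
From mathcomp Require Import all_classical all_reals all_analysis.
From mathcomp Require Import measurable_realfun ring lra.

Set Implicit Arguments.
Unset Strict Implicit.
Unset Printing Implicit Defensive.

Import Order.TTheory GRing.Theory Num.Theory.
Import numFieldNormedType.Exports.

Local Open Scope classical_set_scope.
Local Open Scope ring_scope.

(** Write g_t for the sampled gradient grad f(theta_t; xi_t) and h_t for
    f(theta_t; xi_t) + c, so that v_t = g_t / (2 sqrt h_t).

    Two facts combine. First, r_t is an energy that pays for every gradient
    evaluation: r_{t,i} - r_{t+1,i} = 2 eta r_{t+1,i} v_{t,i}^2, and since h_t
    lies between a and B and |g_t| <= G, this loss is comparable with
    r_{t,i} g_{t,i}^2 ([aegdm_energy_step]).  Telescoping bounds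
    sum_t r_{t,i} g_{t,i}^2 along every trajectory by a multiple of the
    initial energy, which is at most sqrt B ([sum_past_weight_le]).

    Second, the true gradient is the conditional mean of the sampled one, so
    Jensen's inequality gives (d_i f(theta_t))^2 <= E_{xi_t}[g_{t,i}^2].  For
    t >= 1 both theta_t and r_t are functions of xi_0, ..., xi_{t-1}, so the
    inequality survives multiplication by r_{t,i} and integration
    ([integral_sqr_past]).  At t = 0 the energy r_0 depends on xi_0 itself and
    is replaced by its bound sqrt B; this single term costs sqrt B G^2.

    As r decreases in t, min_i r_{T,i} |grad f(theta_t)|^2 is at most
    sum_i r_{t,i} (d_i f(theta_t))^2, and the expectation to be estimated is
    bounded by a constant independent of T.  The inequality |E g|^2 <= E |g|^2
    produces no variance term, so the bound holds with C3 = 0.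

    The measure-theoretic part makes the conditioning on the past rigorous:
    the losses are measurable in the sample and differentiable in the
    parameter, hence jointly measurable along measurable parameters
    ([measurable_fun_carath], [measurable_fun_grad]), and independence turns
    the joint law of the past and the current sample into a product measure,
    to which Tonelli's theorem applies ([ge0_integral_past]). *)

(** * Joint measurability of the losses and of their gradients *)

Lemma cvg_row (R : realType) (n : nat) (u : nat -> 'rV[R]_n) (x : 'rV[R]_n) :
  (forall i, (u k 0 i) @[k --> \oo] --> x 0 i) -> u @ \oo --> x.
Proof.
move=> ux; apply/cvg_ballP => e e0.
have : \forall k \near \oo, forall i, ball (x 0 i) e (u k 0 i).
  apply: filter_forall => i; exact: (cvg_ball (ux i)).
by apply: filterS => k uk; split => // i j; rewrite ord1; exact: uk.
Qed.

(** Caratheodory functions are superposition measurable.  Rounding X down to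
    the grid of mesh 1/(k+1) makes it countably valued, which reduces the claim
    to countably many frozen values of the parameter; continuity recovers F as
    the pointwise limit of these roundings. *)
Lemma measurable_fun_carath (R : realType) (n : nat) (d d' : measure_display)
    (T : measurableType d) (Xi : measurableType d') (F : 'rV[R]_n -> Xi -> R)
    (X : T -> 'rV[R]_n) (S : T -> Xi) :
  (forall x, measurable_fun setT (F x)) ->
  (forall s, continuous (F ^~ s)) ->
  (forall i, measurable_fun setT (fun w => X w 0 i)) ->
  measurable_fun setT S ->
  measurable_fun setT (fun w => F (X w) (S w)).
Proof.
move=> mF cF mX mS.
pose grid k (q : 'rV[int]_n) : 'rV[R]_n := \row_i ((q 0 i)%:~R / k.+1%:R).
pose q k w : 'rV[int]_n := \row_i Num.floor (k.+1%:R * X w 0 i).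
apply: (measurable_fun_cvg
  (h := fun k w => F (grid k (q k w)) (S w))); last first.
  move=> w _; apply: (cvg_comp _ (F ^~ (S w))); last exact: cF.
  apply: cvg_row => i.
  have lo : (X w 0 i - k.+1%:R^-1) @[k --> \oo] --> X w 0 i.
    rewrite -[X in _ --> X]subr0; apply: cvgB; first exact: cvg_cst.
    exact: cvg_harmonic.
  apply: (squeeze_cvgr _ lo (cvg_cst (X w 0 i))).
  apply: nearW => k; rewrite !mxE.
  have := floor_itv (k.+1%:R * X w 0 i).
  set z := Num.floor _; rewrite intrD => /andP[h1 h2].
  have k0 : 0 < k.+1%:R :> R by [].
  rewrite ler_pdivlMr// ler_pdivrMr// mulrBl mulVf ?gt_eqF//.
  by rewrite [X w 0 i * _]mulrC h1 andbT lerBlDr ltW.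
move=> k _ B mB; rewrite setTI.
have -> : (fun w => F (grid k (q k w)) (S w)) @^-1` B =
    \bigcup_(p : 'rV[int]_n) ([set w | forall i, q k w 0 i = p 0 i] `&`
       S @^-1` (F (grid k p) @^-1` B)).
  apply/seteqP; split => [w Bw|w [p _ [/= qp]]].
    by exists (q k w).
  by have -> : q k w = p by apply/rowP.
apply: countable_bigcupT_measurable => // p.
apply: measurableI; last first.
  rewrite -[X in measurable X]setTI; apply: mS => //.
  by rewrite -[X in measurable X]setTI; exact: mF.
have -> : [set w | forall i, q k w 0 i = p 0 i] =
    \bigcap_(i in [set: 'I_n]) [set w | q k w 0 i = p 0 i].
  by apply/seteqP; split => w /= h i; [move=> _|]; exact: h.
apply: fin_bigcap_measurable => // i _.
have -> : [set w | q k w 0 i = p 0 i] = (fun w => k.+1%:R * X w 0 i) @^-1`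
    `[(p 0 i)%:~R, (p 0 i + 1)%:~R[%classic.
  by apply/seteqP; split => w /=; rewrite mxE in_itv/= -floor_eq => /eqP.
rewrite -[X in measurable X]setTI.
by apply: measurable_funM => //; exact: measurable_itv.
Qed.

(** Expressing partial derivatives as limits along a sequence, not along a
    filter, is what makes them measurable. *)
Lemma cvg_grad (R : realType) (n : nat) (g : 'rV[R]_n -> R) (x : 'rV[R]_n)
    (i : 'I_n) : differentiable g x ->
  (k.+1%:R * (g (x + k.+1%:R^-1 *: delta_mx 0 i) - g x)) @[k --> \oo]
    --> grad g x 0 i.
Proof.
move=> dg; rewrite mxE.
have /cvgr_dnbhsP := @diff_derivable _ _ _ g x (delta_mx 0 i) dg.
move=> /(_ (fun k => k.+1%:R^-1)) /=.
rewrite -/('D_(delta_mx 0 i) g x) => h.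
under eq_fun do rewrite [x + _]addrC -[X in X * _]invrK.
by apply: h; split; [move=> k; rewrite invr_neq0| exact: cvg_harmonic].
Qed.

Lemma measurable_fun_grad (R : realType) (n : nat) (d d' : measure_display)
    (T : measurableType d) (Xi : measurableType d') (F : 'rV[R]_n -> Xi -> R)
    (X : T -> 'rV[R]_n) (S : T -> Xi) (i : 'I_n) :
  (forall x, measurable_fun setT (F x)) ->
  (forall s x, differentiable (F ^~ s) x) ->
  (forall j, measurable_fun setT (fun w => X w 0 j)) ->
  measurable_fun setT S ->
  measurable_fun setT (fun w => grad (F ^~ (S w)) (X w) 0 i).
Proof.
move=> mF dF mX mS.
have cF s : continuous (F ^~ s) by move=> x; exact: differentiable_continuous.
apply: (measurable_fun_cvg (h := fun k w => k.+1%:R *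
   (F (X w + k.+1%:R^-1 *: delta_mx 0 i) (S w) - F (X w) (S w)))); last first.
  by move=> w _; exact: cvg_grad.
move=> k; apply: measurable_funM => //; apply: measurable_funB.
  apply: measurable_fun_carath => // j.
  by under eq_fun do rewrite !mxE; exact: measurable_funD.
exact: measurable_fun_carath.
Qed.

(** * Conditioning on the past *)

(** Freezing lemma: independence of X and Y says that the law of (X, Y) is the
    product of the laws, so Tonelli's theorem integrates Y out first, with X
    frozen. *)
Lemma ge0_integral_indep (R : realType) (d d1 d2 : measure_display)
    (Omega : measurableType d) (S : measurableType d1) (Xi : measurableType d2)
    (P : probability Omega R) (X : {RV P >-> S}) (Y : {RV P >-> Xi})
    (K : S * Xi -> \bar R) :
  (forall A B, measurable A -> measurable B ->
    P (X @^-1` A `&` Y @^-1` B) = (P (X @^-1` A) * P (Y @^-1` B))%E) ->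
  measurable_fun setT K -> (forall z, 0 <= K z)%E ->
  measurable_fun setT (fun w => \int[P]_w' K (X w, Y w'))%E /\
  (\int[P]_w K (X w, Y w) = \int[P]_w \int[P]_w' K (X w, Y w'))%E.
Proof.
move=> XY mK K0.
have innerE x : (\int[P]_w' K (x, Y w') = \int[distribution P Y]_y K (x, y))%E.
  by rewrite ge0_integral_distribution//; exact: measurable_fun_pair2.
have mF : measurable_fun setT (fubini_F (distribution P Y) K).
  exact: measurable_fun_fubini_tonelli_F.
split.
  under eq_fun do rewrite innerE.
  exact: (measurableT_comp mF).
have mXY : measurable_fun setT (fun w => (X w, Y w)).
  exact: measurable_fun_pair.
pose XY_mixin := isMeasurableFun.Build _ _ _ _ _ mXY.
pose Z : {mfun Omega >-> (S * Xi)%type} :=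
  HB.pack (fun w => (X w, Y w)) XY_mixin.
rewrite -[LHS](@ge0_integral_distribution _ _ _ _ _ P Z K)//.
rewrite (eq_measure_integral (distribution P X \x distribution P Y)%E);
  last first.
  move=> C mC _; apply/esym; exact: product_measure_unique.
rewrite fubini_tonelli1// ge0_integral_distribution//; last first.
  by move=> x; exact: integral_ge0.
by apply: eq_integral => w _; rewrite innerE.
Qed.

(** A pi-system generating the sigma-algebra of the samples s 0, ..., s t.-1.
    The past is encoded as a coarser sigma-algebra on the same sample space, so
    that a function of w may be measured with respect to either one. *)
Definition past_cylinders (T : Type) (d : measure_display)
    (Xi : measurableType d) (s : nat -> T -> Xi) (t : nat) : set (set T) :=
  [set C | exists2 A : nat -> set Xi, (forall k, measurable (A k)) &
     C = \bigcap_(k in [set` iota 0 t]) (s k @^-1` A k)].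

Section past.
Context (R : realType) (d d' : measure_display) (Omega : measurableType d)
  (Xi : measurableType d') (P : probability Omega R)
  (xis : nat -> {RV P >-> Xi}) (t : nat).

Let Past := g_sigma_algebraType (past_cylinders (fun k => xis k) t).

Lemma measurable_past_sample k : (k < t)%N ->
  measurable_fun setT (xis k : Past -> Xi).
Proof.
move=> kt _ B mB; rewrite setTI; apply: sub_sigma_algebra.
exists (fun j => if j == k then B else setT).
  by move=> j; case: ifP.
apply/seteqP; split => w /= => [Bw j _|/(_ k)].
  by case: eqP => // ->.
by rewrite eqxx; apply => /=; rewrite mem_iota.
Qed.

Lemma past_cylinders_measurable :
  past_cylinders (fun k => xis k) t `<=` measurable.
Proof.
move=> _ [A mA ->]; apply: fin_bigcap_measurable => // k _.
by rewrite -[X in measurable X]setTI; exact: measurable_funPT.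
Qed.

Lemma past_cylinders_setI : setI_closed (past_cylinders (fun k => xis k) t).
Proof.
move=> _ _ [A mA ->] [B mB ->]; exists (fun k => A k `&` B k).
  by move=> k; exact: measurableI.
by rewrite -bigcapI.
Qed.

Lemma past_cylinders_setT : past_cylinders (fun k => xis k) t setT.
Proof.
exists (fun=> setT) => //.
by apply/seteqP; split.
Qed.

(** Mutual independence is the product rule on cylinders.  For fixed B both
    sides are finite measures in A, so they agree on the whole sigma-algebra
    generated by the pi-system of cylinders. *)
Lemma past_indep : mutually_independent xis ->
  forall A B, (measurable : set (set Past)) A -> measurable B ->
  P (A `&` xis t @^-1` B) = (P A * P (xis t @^-1` B))%E.
Proof.
move=> ind A B mA mB.
have mtB : measurable (xis t @^-1` B).
  by rewrite -[X in measurable X]setTI; exact: measurable_funPT.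
have p0 : 0 <= fine (P (xis t @^-1` B)) by exact: fine_ge0.
transitivity (mscale (NngNum p0) P A); last first.
  by rewrite /mscale/= fineK ?fin_num_measure// muleC.
rewrite -[LHS]/(mrestr P mtB A).
apply: (g_sigma_algebra_measure_unique _ past_cylinders_measurable
  (fun=> setT) (fun=> past_cylinders_setT)) => //.
- by rewrite bigcup_const.
- exact: past_cylinders_setI.
- move=> _ [C mC ->].
  rewrite /= /mrestr /mscale/= fineK ?fin_num_measure// muleC.
  have := ind (iota 0 t) C (iota_uniq _ _) mC => ->.
  (* The cylinder and the event on sample t form a cylinder of length t+1. *)
  pose C' k := if k == t then B else C k.
  have mC' k : measurable (C' k) by rewrite /C'; case: ifP.
  have := ind (iota 0 t.+1) C' (iota_uniq _ _) mC'.
  have C't : C' t = B by rewrite /C' eqxx.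
  have C'E k : k \in iota 0 t -> C' k = C k.
    by rewrite mem_iota add0n /C' => /= /ltn_eqF ->.
  rewrite -addn1 iotaD/= big_cat/= big_seq1 add0n C't.
  rewrite [X in (X * _)%E](eq_big_seq (fun k => P (xis k @^-1` C k)));
    last first.
    by move=> k /C'E ->.
  move=> <-; congr (P _); apply/seteqP; split => w /=.
    move=> [Cw Bw] k /=; rewrite mem_cat inE => /orP[kt|/eqP ->].
      by rewrite C'E//; exact: Cw.
    by rewrite C't.
  move=> h; split.
    by move=> k /= kt; rewrite -C'E//; apply: h; rewrite /= mem_cat kt.
  by rewrite -C't; apply: h; rewrite /= mem_cat inE eqxx orbT.
- by move=> _; rewrite ltey_eq fin_num_measure.
Qed.

Lemma ge0_integral_past (K : Past * Xi -> \bar R) :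
  mutually_independent xis ->
  measurable_fun setT K -> (forall z, 0 <= K z)%E ->
  measurable_fun [set: Omega] (fun w => \int[P]_w' K (w, xis t w'))%E /\
  (\int[P]_w K (w, xis t w) = \int[P]_w \int[P]_w' K (w, xis t w'))%E.
Proof.
move=> ind mK K0.
have mid : measurable_fun [set: Omega] (id : Omega -> Past).
  move=> _ A mA; rewrite setTI.
  apply: (smallest_sub (@sigma_algebra_measurable _ Omega)) mA.
  exact: past_cylinders_measurable.
pose id_mixin := isMeasurableFun.Build _ _ _ _ _ mid.
pose X : {mfun Omega >-> Past} := HB.pack (id : Omega -> Past) id_mixin.
apply: (@ge0_integral_indep _ _ _ _ _ _ _ P X (xis t) K) => // A B mA mB.
exact: past_indep.
Qed.

End past.

(** * Jensen's inequality *)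

(** Obtained by integrating the tangent line bound 2 m x - m^2 <= x^2.  The
    integral on the right may be infinite. *)
Lemma sqr_expectation_le (R : realType) (d : measure_display)
    (T : measurableType d) (P : probability T R) (X : T -> R) (m : R) :
  measurable_fun setT X -> expectation P X = m%:E ->
  ((m ^+ 2)%:E <= \int[P]_w (X w ^+ 2)%:E)%E.
Proof.
move=> mX; rewrite unlock => EX.
have mX2 : measurable_fun setT (fun w => (X w ^+ 2)%:E).
  by apply/measurable_EFinP; exact: measurable_funX.
have [->|X2oo] := eqVneq (\int[P]_w (X w ^+ 2)%:E)%E +oo%E; first exact: leey.
have iX2 : P.-integrable setT (EFin \o (fun w => X w ^+ 2)).
  apply/integrableP; split => //.
  under eq_integral do rewrite /= ger0_norm ?sqr_ge0//.
  by rewrite ltey.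
have i1 k : P.-integrable setT (EFin \o cst k).
  exact: finite_measure_integrable_cst.
have iX : P.-integrable setT (EFin \o X).
  apply: (le_integrable _ _ _ (integrableD _ iX2 (i1 1))) => //.
    exact/measurable_EFinP.
  move=> w _ /=; rewrite lee_fin [leRHS]ger0_norm ?addr_ge0 ?sqr_ge0//.
  by rewrite -real_normK ?num_real//; nra.
have iZ : P.-integrable setT (EFin \o (fun w => 2 * m * X w)).
  by have := integrableZl measurableT (2 * m) iX; apply: eq_integrable.
have <- : (\int[P]_w ((2 * m * X w)%:E - (m ^+ 2)%:E) = (m ^+ 2)%:E)%E.
  rewrite (integralB_EFin measurableT iZ (i1 (m ^+ 2))).
  under eq_integral do rewrite EFinM.
  rewrite integralZl// EX.
  rewrite [X in (_ - X)%E](integral_cst P measurableT (m ^+ 2)%:E).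
  rewrite /= probability_setT mule1.
  by rewrite -EFinM -EFinB; congr EFin; ring.
apply: le_integral => //.
  exact: (integrableB _ iZ (i1 (m ^+ 2))).
by move=> w _; rewrite -EFinB lee_fin; have := sqr_ge0 (X w - m); lra.
Qed.

(** Conditional Jensen inequality with a weight from the past: rho and G(., y)
    depend on the first t samples only, so freezing them reduces the claim to
    [sqr_expectation_le] under the weight rho. *)
Lemma integral_sqr_past (R : realType) (d d' : measure_display)
    (Omega : measurableType d) (Xi : measurableType d')
    (P : probability Omega R) (xis : nat -> {RV P >-> Xi}) (t : nat)
    (Past := g_sigma_algebraType (past_cylinders (fun k => xis k) t))
    (G : Past * Xi -> R) (rho : Past -> R) (h : Omega -> R) :
  mutually_independent xis ->
  measurable_fun setT G -> measurable_fun setT rho -> (forall w, 0 <= rho w) ->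
  measurable_fun [set: Omega] (fun w => rho w * h w ^+ 2) ->
  {ae P, forall w, expectation P (fun w' => G (w, xis t w')) = (h w)%:E} ->
  (\int[P]_w (rho w * h w ^+ 2)%:E <=
   \int[P]_w (rho w * G (w, xis t w) ^+ 2)%:E)%E.
Proof.
move=> ind mG mrho rho0 mh EG.
pose K (z : Past * Xi) := (rho z.1 * G z ^+ 2)%:E.
have mK : measurable_fun setT K.
  apply/measurable_EFinP; apply: measurable_funM; last exact: measurable_funX.
  exact: (measurableT_comp mrho).
have K0 z : (0 <= K z)%E by rewrite lee_fin mulr_ge0 ?sqr_ge0.
have [mI ->] := ge0_integral_past ind mK K0.
apply: ae_ge0_le_integral => //.
- by move=> w _; rewrite lee_fin mulr_ge0 ?sqr_ge0.
- exact/measurable_EFinP.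
- by move=> w _; exact: integral_ge0.
have FP := ae_filter_ringOfSetsType P.
move: EG; apply: filterS => w EGw _.
have mGw : measurable_fun setT (fun w' => G (w, xis t w')).
  exact: (measurableT_comp (measurable_fun_pair2 _ mG)).
rewrite /K /=; under eq_integral do rewrite EFinM.
rewrite ge0_integralZl ?lee_fin//.
- by rewrite EFinM lee_wpmul2l ?lee_fin//; exact: sqr_expectation_le.
- by apply/measurable_EFinP; exact: measurable_funX.
- by move=> w' _; rewrite lee_fin sqr_ge0.
Qed.

(** * Measurability of the iterates *)

Lemma measurable_fun_divr (R : realType) (d : measure_display)
    (T : measurableType d) (g h : T -> R) :
  (forall w, 0 < h w) -> measurable_fun setT g -> measurable_fun setT h ->
  measurable_fun setT (fun w => g w / h w).
Proof.
move=> h0 mg mh; apply: measurable_funM => //.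
under eq_fun do rewrite -powR_inv1 ?ltW//.
exact: (measurableT_comp (measurable_powR _)).
Qed.

Section trajectory.
Context (R : realType) (n : nat) (d d' : measure_display)
  (T : measurableType d) (Xi : measurableType d').
Variables (F : 'rV[R]_n -> Xi -> R) (c eta mu : R) (x0 : 'rV[R]_n)
  (s : nat -> T -> Xi).
Hypotheses (mF : forall x, measurable_fun setT (F x))
  (dF : forall y x, differentiable (F ^~ y) x)
  (F0 : forall x y, 0 < F x y + c) (eta0 : 0 < eta).

Let state t w := aegdm F c eta mu x0 (fun k => s k w) t.

Lemma measurable_loss (X : T -> 'rV[R]_n) (S : T -> Xi) :
  (forall j, measurable_fun setT (fun w => X w 0 j)) ->
  measurable_fun setT S ->
  measurable_fun setT (fun w => F (X w) (S w)).
Proof.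
move=> mX mS; apply: measurable_fun_carath => // y x.
exact: differentiable_continuous.
Qed.

Lemma measurable_aegdm_v (X : T -> 'rV[R]_n) (S : T -> Xi) i :
  (forall j, measurable_fun setT (fun w => X w 0 j)) ->
  measurable_fun setT S ->
  measurable_fun setT (fun w => aegdm_v F c (X w) (S w) 0 i).
Proof.
move=> mX mS; under eq_fun do rewrite mxE.
apply: measurable_fun_divr => [w||].
- by rewrite mulr_gt0// sqrtr_gt0.
- exact: measurable_fun_grad.
apply: measurable_funM => //.
apply: (measurableT_comp (continuous_measurable_fun (@sqrt_continuous R))).
by apply: measurable_funD => //; exact: measurable_loss.
Qed.

(** The bound k <= t.-1 reflects that the state at time t depends on the samples
    before t, except that r_0 already uses sample 0.  The space T is arbitrary:
    it is used for the full sample space and for its coarser sigma-algebra of the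
    past. *)
Lemma measurable_aegdm t :
  (forall k, (k <= t.-1)%N -> measurable_fun setT (s k)) ->
  forall i, [/\ measurable_fun setT (fun w => st_theta (state t w) 0 i),
    measurable_fun setT (fun w => st_m (state t w) 0 i) &
    measurable_fun setT (fun w => st_r (state t w) 0 i)].
Proof.
elim: t => [ms i|t IH ms].
  split=> /=; [exact: measurable_cst|exact: measurable_cst|].
  under eq_fun do rewrite mxE.
  apply: (measurableT_comp (continuous_measurable_fun (@sqrt_continuous R))).
  by apply: measurable_funD => //; apply: measurable_loss => //; exact: ms.
have {}IH i : [/\ measurable_fun setT (fun w => st_theta (state t w) 0 i),
    measurable_fun setT (fun w => st_m (state t w) 0 i) &
    measurable_fun setT (fun w => st_r (state t w) 0 i)].
  by apply: IH => k kt; apply: ms; rewrite (leq_trans kt)//= leq_pred.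
have mv i : measurable_fun setT
    (fun w => aegdm_v F c (st_theta (state t w)) (s t w) 0 i).
  by apply: measurable_aegdm_v => [j|]; [have [] := IH j|exact: ms].
have mm i : measurable_fun setT (fun w => st_m (state t.+1 w) 0 i).
  rewrite /state /=; under eq_fun do rewrite mxE [X in X + _]mxE.
  by apply: measurable_funD => //; apply: measurable_funM => //; have [] := IH i.
have mr i : measurable_fun setT (fun w => st_r (state t.+1 w) 0 i).
  rewrite /state /=; under eq_fun do rewrite mxE.
  apply: measurable_fun_divr => [w||].
  - by rewrite ltr_wpDr// mulr_ge0 ?sqr_ge0// mulr_ge0// ltW.
  - by have [] := IH i.
  - apply: measurable_funD => //; apply: measurable_funM => //.
    exact: measurable_funX.
move=> i; split => //.
rewrite /state /=; under eq_fun do rewrite mxE.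
apply: measurable_funB; first by have [] := IH i.
apply: measurable_funM; last exact: mm.
by apply: measurable_funM => //; exact: mr.
Qed.

Lemma measurable_aegdm_theta t :
  (forall k, (k < t)%N -> measurable_fun setT (s k)) ->
  forall i, measurable_fun setT (fun w => st_theta (state t w) 0 i).
Proof.
case: t => [_ i|t ms i]; first exact: measurable_cst.
by have [] := @measurable_aegdm t.+1 ms i.
Qed.

End trajectory.

(** * Energy dissipation along a trajectory *)

Lemma sqr_norm2 (R : realType) (n : nat) (u : 'rV[R]_n) :
  norm2 u ^+ 2 = \sum_i u 0 i ^+ 2.
Proof.
rewrite /norm2 sqr_sqrtr; last first.
  by apply: sumr_ge0 => i _; rewrite -expr2 sqr_ge0.
by apply: eq_bigr => i _; rewrite expr2.
Qed.

(** Bounds the ratio of the weighted squared gradient entry r_{t,i} g_{t,i}^2 to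
    the dissipated energy r_{t,i} - r_{t+1,i}. *)
Definition energy_ratio (R : realType) (eta a B G : R) : R :=
  2 * B * (1 + eta * G ^+ 2 / (2 * a)) / eta.

Lemma energy_ratio_ge0 (R : realType) (eta a B G : R) :
  0 < eta -> 0 < a -> 0 <= B -> 0 <= energy_ratio eta a B G.
Proof.
move=> /ltW eta0 /ltW a0 B0; rewrite divr_ge0//; apply: mulr_ge0.
  exact: mulr_ge0.
by rewrite addr_ge0//; apply: divr_ge0; apply: mulr_ge0 => //; exact: sqr_ge0.
Qed.

Section pathwise.
Context (R : realType) (n : nat) (Xi : Type).
Variables (F : 'rV[R]_n -> Xi -> R) (c eta mu : R) (x0 : 'rV[R]_n)
  (s : nat -> Xi).
Hypotheses (F0 : forall x y, 0 < F x y + c) (eta0 : 0 < eta).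

Let theta t := aegdm_theta F c eta mu x0 s t.
Let r t := aegdm_r F c eta mu x0 s t.
Let v t := aegdm_v F c (theta t) (s t).

Let rS t i : r t.+1 0 i = r t 0 i / (1 + 2 * eta * v t 0 i ^+ 2).
Proof. by rewrite /r /aegdm_r /= mxE. Qed.

Let den_ge1 t i : 1 <= 1 + 2 * eta * v t 0 i ^+ 2.
Proof. by rewrite lerDl mulr_ge0 ?sqr_ge0// mulr_ge0// ltW. Qed.

Lemma aegdm_r_gt0 t i : 0 < r t 0 i.
Proof.
elim: t => [|t IH]; first by rewrite /r /aegdm_r /= mxE sqrtr_gt0.
by rewrite rS divr_gt0// (lt_le_trans ltr01).
Qed.

Lemma aegdm_r_nincr i : {homo (fun t => r t 0 i) : t u / (t <= u)%N >-> u <= t}.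
Proof.
apply: homo_leq => // [x y z xy /le_trans|t]; first exact.
rewrite rS ler_pdivrMr ?(lt_le_trans ltr01)//.
by rewrite ler_peMr// ltW// aegdm_r_gt0.
Qed.

(** With h the shifted loss, g_i^2 = 4 h v_i^2 and r' = r_{t+1} satisfies
    r_t = r' (1 + 2 eta v_i^2), so that
    r_t g_i^2 = 4 h v_i^2 r' (1 + 2 eta v_i^2) while
    r_t - r' = 2 eta r' v_i^2.  The bounds h <= B and
    2 v_i^2 = g_i^2 / (2 h) <= G^2 / (2 a) give the ratio. *)
Lemma aegdm_energy_step a B G t i : 0 < a ->
  norm2 (grad (F ^~ (s t)) (theta t)) <= G -> a <= F (theta t) (s t) + c <= B ->
  r t 0 i * grad (F ^~ (s t)) (theta t) 0 i ^+ 2 <=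
    energy_ratio eta a B G * (r t 0 i - r t.+1 0 i).
Proof.
move=> a0 gG /andP[ah hB].
set g := grad _ _; set h := F (theta t) (s t) + c in ah hB *.
have h0 : 0 < h by exact: lt_le_trans ah.
have gi : g 0 i ^+ 2 <= G ^+ 2.
  apply: (@le_trans _ _ (norm2 g ^+ 2)).
    by rewrite sqr_norm2 (bigD1 i)//= lerDl sumr_ge0// => j _; rewrite sqr_ge0.
  by rewrite lerXn2r ?nnegrE// ?(le_trans _ gG) ?sqrtr_ge0.
have v2 : v t 0 i ^+ 2 * (4 * h) = g 0 i ^+ 2.
  rewrite /v mxE -/g -/h exprMn exprVn exprMn sqr_sqrtr ?ltW//.
  by field; rewrite gt_eqF.
have den0 : 0 < 1 + 2 * eta * v t 0 i ^+ 2 by exact: lt_le_trans ltr01 _.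
have rE : r t 0 i = r t.+1 0 i * (1 + 2 * eta * v t 0 i ^+ 2).
  by rewrite rS divfK// gt_eqF.
have r0 := aegdm_r_gt0 t.+1 i.
have vle : 2 * v t 0 i ^+ 2 <= G ^+ 2 / (2 * a).
  rewrite ler_pdivlMr ?mulr_gt0//.
  have := sqr_ge0 (v t 0 i); nra.
have w0 := sqr_ge0 (v t 0 i).
set w := v t 0 i ^+ 2 in v2 rE vle w0 *; set r' := r t.+1 0 i in rE r0 *.
rewrite -v2 rE.
have -> : energy_ratio eta a B G * (r' * (1 + 2 * eta * w) - r') =
  4 * w * r' * (B * (1 + eta * (G ^+ 2 / (2 * a)))).
  by rewrite /energy_ratio; field; rewrite !gt_eqF.
have -> : r' * (1 + 2 * eta * w) * (w * (4 * h)) =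
  4 * w * r' * (h * (1 + eta * (2 * w))) by ring.
rewrite ler_wpM2l//; first by apply: mulr_ge0; [exact: mulr_ge0|exact: ltW].
apply: ler_pM => //; first exact: ltW.
  by rewrite addr_ge0//; apply: mulr_ge0; [exact: ltW|exact: mulr_ge0].
by rewrite lerD2l ler_pM2l.
Qed.

(** The energy r_t, with r_0 replaced by its almost sure bound: unlike r_0,
    which depends on sample 0, this weight at time t only depends on the samples
    before t. *)
Definition past_weight (B : R) (t : nat) (i : 'I_n) : R :=
  if t is 0 then Num.sqrt B else r t 0 i.

Lemma past_weight_ge0 B t i : 0 <= past_weight B t i.
Proof. by case: t => [|t]; [exact: sqrtr_ge0|exact/ltW/aegdm_r_gt0]. Qed.

Lemma aegdm_r_le_past_weight B t u i : F (theta 0) (s 0) + c <= B ->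
  (t <= u)%N -> r u 0 i <= past_weight B t i.
Proof.
move=> hB tu; apply: (le_trans (aegdm_r_nincr i tu)).
case: t {tu} => //=; rewrite /r /aegdm_r /= mxE ler_sqrt//.
by rewrite (le_trans _ hB)// ltW.
Qed.

(** The term t = 0, where the weight is not the energy, is bounded directly by
    sqrt B G^2; the other terms telescope to at most r_1 <= sqrt B for each
    coordinate. *)
Lemma sum_past_weight_le a B G T : 0 < a -> (0 < T)%N ->
  (forall t, norm2 (grad (F ^~ (s t)) (theta t)) <= G) ->
  (forall t, a <= F (theta t) (s t) + c <= B) ->
  \sum_(0 <= t < T) \sum_i
     past_weight B t i * grad (F ^~ (s t)) (theta t) 0 i ^+ 2 <=
  Num.sqrt B * G ^+ 2 +
    n%:R * (energy_ratio eta a B G * Num.sqrt B).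
Proof.
move=> a0 T0 gG hB; case: T T0 => // T _.
have G0 : 0 <= G by rewrite (le_trans _ (gG 0))// sqrtr_ge0.
have B0 : 0 < B.
  by have /andP[ah hB0] := hB 0; exact: lt_le_trans (lt_le_trans a0 ah) hB0.
set K := energy_ratio eta a B G.
have K0 : 0 <= K by rewrite energy_ratio_ge0 ?ltW.
rewrite big_nat_recl//; apply: lerD.
  rewrite -mulr_sumr -sqr_norm2 ler_wpM2l ?sqrtr_ge0//.
  by rewrite lerXn2r ?nnegrE// sqrtr_ge0.
rewrite exchange_big/= -[n in n%:R]card_ord -sum1_card natr_sum mulr_suml.
apply: ler_sum => i _; rewrite mul1r.
apply: (@le_trans _ _ (\sum_(0 <= t < T) K * (r t.+1 0 i - r t.+2 0 i))).
  by apply: ler_sum => t _; exact: aegdm_energy_step.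
rewrite -mulr_sumr ler_wpM2l//.
rewrite (telescope_sumr_eq (fun t => - r t.+1 0 i))//; last first.
  by move=> t _; rewrite opprK addrC.
rewrite opprK addrC lerBlDr (@le_trans _ _ (Num.sqrt B))//.
  by apply: (@aegdm_r_le_past_weight B 0) => //; have /andP[] := hB 0.
by rewrite lerDl ltW// aegdm_r_gt0.
Qed.

End pathwise.

(** * The convergence bound *)

Lemma min_entry_le (R : realType) (n : nat) (u : 'rV[R]_n.+1) i :
  min_entry u <= u 0 i.
Proof. exact: bigmin_le_cond. Qed.

Lemma min_entry_ge0 (R : realType) (n : nat) (u : 'rV[R]_n.+1) :
  (forall i, 0 <= u 0 i) -> 0 <= min_entry u.
Proof. by move=> u0; apply/bigmin_geP; split=> [|i _]; exact: u0. Qed.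

Lemma measurable_min_entry (R : realType) (n : nat) (d : measure_display)
    (T : measurableType d) (U : T -> 'rV[R]_n.+1) :
  (forall i, measurable_fun setT (fun w => U w 0 i)) ->
  measurable_fun setT (fun w => min_entry (U w)).
Proof.
move=> mU; rewrite /min_entry.
elim: (index_enum _) => [|i s IH].
  by under eq_fun do rewrite big_nil; exact: mU.
by under eq_fun do rewrite big_cons; exact: measurable_minr.
Qed.

Lemma le_integral_sum (R : realType) (d : measure_display)
    (T : measurableType d) (P : {measure set T -> \bar R}) (I : eqType)
    (r : seq I) (g h : I -> T -> R) :
  (forall i w, 0 <= g i w) -> (forall i w, 0 <= h i w) ->
  (forall i, measurable_fun setT (g i)) ->
  (forall i, measurable_fun setT (h i)) ->
  (forall i, (\int[P]_w (g i w)%:E <= \int[P]_w (h i w)%:E)%E) ->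
  (\int[P]_w (\sum_(i <- r) g i w)%:E <= \int[P]_w (\sum_(i <- r) h i w)%:E)%E.
Proof.
move=> g0 h0 mg mh gh.
under eq_integral do rewrite -sumEFin.
under [leRHS]eq_integral do rewrite -sumEFin.
rewrite !ge0_integral_sum//.
- by apply: lee_sum => i _.
- by move=> i; exact/measurable_EFinP.
- by move=> i w _; rewrite lee_fin.
- by move=> i; exact/measurable_EFinP.
- by move=> i w _; rewrite lee_fin.
Qed.

Theorem theorem4p6 (R : realType) (n : nat) (mu eta L Ginf a B V0 : R)
    (hmu0 : 0 <= mu) (hmu1 : mu < 1) (heta : 0 < eta) (ha : 0 < a) :
  exists C1 C2 C3 : R,
  forall (d d' : measure_display) (Omega : measurableType d)
    (Xi : measurableType d') (P : probability Omega R)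
    (xi : {RV P >-> Xi}) (xis : nat -> {RV P >-> Xi})
    (F : 'rV[R]_n.+1 -> Xi -> R) (f : 'rV[R]_n.+1 -> R) (c : R)
    (theta0 : 'rV[R]_n.+1) (sigma_g sigma_f : R),
  let theta := fun (t : nat) (w : Omega) =>
    aegdm_theta F c eta mu theta0 (fun k => xis k w) t in
  let r := fun (t : nat) (w : Omega) =>
    aegdm_r F c eta mu theta0 (fun k => xis k w) t in
  (forall x, measurable_fun [set: Xi] (F x)) ->
  (forall s x, differentiable (F ^~ s) x) ->
  (forall x s, 0 < F x s + c) ->
  (forall x, (f x)%:E = expectation P (fun w => F x (xi w))) ->
  (forall x, differentiable f x) ->
  (forall t, same_distribution (xis t) xi) ->
  f theta0 + c = V0 ->
  0 <= sigma_g -> 0 <= sigma_f ->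
  L_smooth L f ->
  mutually_independent xis ->
  (forall t, {ae P, forall w, forall i : 'I_n.+1,
     expectation P (fun w' => grad (F ^~ (xis t w')) (theta t w) 0 i)
       = (grad f (theta t w) 0 i)%:E}) ->
  (forall t, {ae P, forall w,
     expectation P (fun w' => F (theta t w) (xis t w')) = (f (theta t w))%:E}) ->
  (forall t, {ae P, forall w,
     (expectation P (fun w' => norm2 (grad (F ^~ (xis t w')) (theta t w)
                                     - grad f (theta t w)) ^+ 2)%R
       <= (sigma_g ^+ 2)%:E)%E}) ->
  (forall t, {ae P, forall w,
     (expectation P (fun w' =>
        `|F (theta t w) (xis t w') - f (theta t w)| ^+ 2)%R
       <= (sigma_f ^+ 2)%:E)%E}) ->
  (forall t, {ae P, forall w,
     norm2 (grad (F ^~ (xis t w)) (theta t w)) <= Ginf}) ->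
  (forall t, {ae P, forall w, a <= F (theta t w) (xis t w) + c <= B}) ->
  forall T : nat, (0 < T)%N ->
  ((T%:R^-1)%:E *
     expectation P (fun w => min_entry (r T w) *
       \sum_(0 <= t < T) norm2 (grad f (theta t w)) ^+ 2)%R
   <= ((C1 + C2 * n.+1%:R + C3 * sigma_g * Num.sqrt (n.+1 * T)%:R)
        / (eta * T%:R))%:E)%E.
Proof.
pose K := energy_ratio eta a B Ginf.
(* The constants are scaled by eta to cancel the eta of the denominator. *)
exists (eta * (Num.sqrt B * Ginf ^+ 2)), (eta * (K * Num.sqrt B)), 0.
move=> d d' Omega Xi P xi xis F f c x0 sg sf theta r mF dF F0 _ df _ _ _ _ _.
move=> ind unbiased _ _ _ gG hB T T0.
have mxi k : measurable_fun setT (xis k) by [].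
pose g t w := grad (F ^~ (xis t w)) (theta t w).
pose rho t i w := past_weight F c eta mu x0 (fun k => xis k w) B t i.
have mstate t := measurable_aegdm mu x0 mF dF F0 heta
  (fun k (_ : (k <= t.-1)%N) => mxi k).
have mtheta t i : measurable_fun setT (fun w => theta t w 0 i).
  by have [] := mstate t i.
have mr t i : measurable_fun setT (fun w => r t w 0 i).
  by have [] := mstate t i.
have mgradf t i : measurable_fun setT (fun w => grad f (theta t w) 0 i).
  have := measurable_fun_grad (F := fun x (_ : Xi) => f x) i _ _ (mtheta t).
  by move=> /(_ (xis 0)); apply.
have mg t i : measurable_fun setT (fun w => g t w 0 i).
  exact: measurable_fun_grad.
have rho0 t i w : 0 <= rho t i w by exact: past_weight_ge0.
have mrho t i : measurable_fun setT (rho t i).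
  by case: t => [|t]; [exact: measurable_cst|exact: (mr t.+1 i)].
have mrhof t i : measurable_fun setT
    (fun w => rho t i w * grad f (theta t w) 0 i ^+ 2).
  by apply: measurable_funM => //; exact: measurable_funX.
have mrhog t i : measurable_fun setT (fun w => rho t i w * g t w 0 i ^+ 2).
  by apply: measurable_funM => //; exact: measurable_funX.
have rhof0 t i w : 0 <= rho t i w * grad f (theta t w) 0 i ^+ 2.
  by rewrite mulr_ge0// sqr_ge0.
have rhog0 t i w : 0 <= rho t i w * g t w 0 i ^+ 2.
  by rewrite mulr_ge0// sqr_ge0.
have step t i : (\int[P]_w (rho t i w * grad f (theta t w) 0 i ^+ 2)%:E <=
    \int[P]_w (rho t i w * g t w 0 i ^+ 2)%:E)%E.
  (* theta_t and the weight are measurable for the sigma-algebra of the past. *)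
  pose Past := g_sigma_algebraType (past_cylinders (fun k => xis k) t).
  pose G (z : Past * Xi) := grad (F ^~ z.2) (theta t z.1) 0 i.
  apply: (@integral_sqr_past _ _ _ _ _ _ xis t G (rho t i)) => //.
  - apply: measurable_fun_grad => // j.
    apply: (@measurableT_comp _ _ _ _ _ _ (fun w : Past => theta t w 0 j)) => //.
    apply: measurable_aegdm_theta => // k kt.
    exact: measurable_past_sample.
  - case: t @Past @G => [|t] Past G; first exact: measurable_cst.
    have ms k : (k <= t.+1.-1)%N -> measurable_fun setT (xis k : Past -> Xi).
      by move=> kt; exact: measurable_past_sample.
    by have [] := measurable_aegdm mu x0 mF dF F0 heta ms i.
  - have FP := ae_filter_ringOfSetsType P.
    by move: (unbiased t); apply: filterS => w; exact.
have FP := ae_filter_ringOfSetsType P.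
have good : {ae P, forall w, (forall t, norm2 (g t w) <= Ginf) /\
    (forall t, a <= F (theta t w) (xis t w) + c <= B)}.
  have /ae_foralln gG' := gG; have /ae_foralln hB' := hB.
  by move: gG' hB'; apply: filterS2.
have bound : (\int[P]_w (min_entry (r T w) *
      \sum_(0 <= t < T) norm2 (grad f (theta t w)) ^+ 2)%:E <=
    (Num.sqrt B * Ginf ^+ 2 + n.+1%:R * (K * Num.sqrt B))%:E)%E.
  apply: (@le_trans _ _ (\int[P]_w (\sum_(0 <= t < T) \sum_i
      rho t i w * grad f (theta t w) 0 i ^+ 2)%:E)%E).
    apply: ae_ge0_le_integral => //.
    - move=> w _; rewrite lee_fin mulr_ge0//.
        by apply: min_entry_ge0 => i; apply/ltW/aegdm_r_gt0.
      by apply: sumr_ge0 => t _; rewrite sqr_ge0.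
    - apply/measurable_EFinP; apply: measurable_funM.
        exact: measurable_min_entry.
      apply: measurable_sum => t; under eq_fun do rewrite sqr_norm2.
      by apply: measurable_sum => i; exact: measurable_funX.
    - by move=> w _; rewrite lee_fin !sumr_ge0// => t _; rewrite sumr_ge0.
    - apply/measurable_EFinP; apply: measurable_sum => t.
      exact: measurable_sum.
    move: good; apply: filterS => w [_ hBw] _.
    rewrite lee_fin mulr_sumr big_nat_cond [leRHS]big_nat_cond ler_sum// => t.
    rewrite andbT => /andP[_ tT].
    rewrite sqr_norm2 mulr_sumr ler_sum// => i _.
    rewrite ler_wpM2r ?sqr_ge0//; apply: (le_trans (min_entry_le _ i)).
    apply: aegdm_r_le_past_weight => //; last exact: ltnW.
    by have /andP[] := hBw 0.
  apply: (@le_trans _ _ (\int[P]_w (\sum_(0 <= t < T) \sum_i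
      rho t i w * g t w 0 i ^+ 2)%:E)%E).
    apply: le_integral_sum => [t w|t w|t|t|t].
    - by rewrite sumr_ge0.
    - by rewrite sumr_ge0.
    - exact: measurable_sum.
    - exact: measurable_sum.
    - exact: le_integral_sum.
  set D := _ + _.
  rewrite -[leRHS]mule1 -(probability_setT P) -(integral_cst P measurableT D%:E).
  apply: ae_ge0_le_integral => //.
  - by move=> w _; rewrite lee_fin !sumr_ge0// => t _; rewrite sumr_ge0.
  - apply/measurable_EFinP; apply: measurable_sum => t.
    exact: measurable_sum.
  (* For B <= 0 the second term vanishes with sqrt B. *)
  - move=> w _ /=; rewrite lee_fin addr_ge0// mulr_ge0 ?sqr_ge0//.
    have [B0|/ltW B0] := leP 0 B; last by rewrite ler0_sqrtr// mulr0.
    by rewrite mulr_ge0// energy_ratio_ge0.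
  move: good; apply: filterS => w [gw hw] _.
  by rewrite lee_fin; exact: sum_past_weight_le.
rewrite unlock; set E := (X in (_ * X <= _)%E).
apply: (@le_trans _ _ ((T%:R^-1)%:E *
   (Num.sqrt B * Ginf ^+ 2 + n.+1%:R * (K * Num.sqrt B))%:E)%E).
  by rewrite lee_wpmul2l// lee_fin invr_ge0.
rewrite -EFinM lee_fin !mul0r addr0 le_eqVlt; apply/orP; left; apply/eqP.
by field; rewrite pnatr_eq0 -lt0n T0 gt_eqF.
Qed.
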